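(* Let $R$ be a commutative unital ring, let $S$ be an inverse semigroup, and let $\theta=(\{X_s\}_{s\in S},\{\theta_s\}_{s\in S})$ be a topological partial action of $S$ on a locally compact Hausdorff zero-dimensional topological space $X$. Let $\alpha=(\{D_s\}_{s\in S},\{\alpha_s\}_{s\in S})$ be the dual partial action of $\theta$ on $A_R(X)$. Then the Steinberg algebra $A_R(S\ltimes_\theta X)$ is isomorphic to the crossed product $A_R(X)\rtimes_\alpha S$.
   Context: An inverse semigroup $S$ is a semigroup in which every $s$ has a unique $s^*$ with $ss^*s=s$, $s^*ss^*=s^*$; $E(S)$ is its set of idempotents, and $s\le t$ means $s=ts^*s$. For a set $X$, $\mathcal{I}(X)$ is the inverse semigroup of partial bijections of $X$ under composition of partial maps. A partial homomorphism $\varphi:S\to T$ of inverse semigroups satisfies $\varphi(s^* )=\varphi(s)^*$, $\varphi(s)\varphi(t)\le\varphi(st)$, and $\varphi(s)\le\varphi(t)$ whenever $s\le t$. A topological partial action $\theta=(\{X_s\},\{\theta_s\})$ of $S$ on a space $X$ consists of open sets $X_s\subseteq X$ and homeomorphisms $\theta_s:X_{s^*}\to X_s$ such that $s\mapsto\theta_s$ is a partial homomorphism $S\to\mathcal{I}(X)$ and $X=\bigcup_{e\in E(S)}X_e$. Groupoid of germs: let $S*X=\{(s,x)\in S\times X: x\in X_{s^*}\}$; declare $(s,x)\sim(t,y)$ iff $x=y$ and there is $u\in S$ with $u\le s$, $u\le t$, $x\in X_{u^*}$. The germ $[s,x]$ is the class of $(s,x)$. $S\ltimes_\theta X$ is the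 set of germs, with source $x$, range $\theta_s(x)$, product $[s,x][t,y]=[st,y]$ when $x=\theta_t(y)$, inverse $[s^*,\theta_s(x)]$, unit space identified with $X$, and topology with basis the sets $[s,U]=\{[s,x]:x\in U\}$ for $s\in S$ and $U\subseteq X_{s^*}$ open. Steinberg algebras: for an ample groupoid $\mathcal{G}$ (an étale groupoid whose unit space is locally compact Hausdorff with a basis of compact-open sets), $A_R(\mathcal{G})$ is the $R$-span, inside the $R$-valued functions on $\mathcal{G}$, of characteristic functions of compact-open bisections, with convolution $(f*g)(a)=\sum_{bc=a}f(b)g(c)$. For $X$ locally compact Hausdorff zero-dimensional, $A_R(X)$ is the algebra of locally constant compactly supported functions $X\to R$ with pointwise operations. Dual partial action: $D_s=\{f\in A_R(X):\operatorname{supp}f\subseteq X_s\}$ and $\alpha_s:D_{s^*}\to D_s$, $\alpha_s(f)=f\circ\theta_{s^*}$ on $X_s$, extended by $0$ outside $X_s$. Crossed product: for an algebraic partial action $\alpha=(\{A_s\},\{\alpha_s\})$ of $S$ on an $R$-algebra $A$ (ideals $A_s$, $R$-isomorphisms $\alpha_s:A_{s^*}\to A_s$, $s\mapsto\alpha_s$ a partial homomorphism into $\mathcal{I}(A)$, and $A=\operatorname{span}_R\bigcup_{e\in E(S)}A_e$), let $\mathscr{L}$ be the $R$-module of finite formal sums $\sum a_s\delta_s$ with $a_s\in A_s$, with product $(a_s\delta_s)(b_t\delta_t)=\alpha_s(\alpha_{s^*}(a_s)b_t)\delta_{st}$, and let $\mathscr{N}$ be the additive subgroup generated by $a\delta_r-a\delta_s$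 with $r\le s$, $a\in A_r$. Then $A\rtimes_\alpha S=\mathscr{L}/\mathscr{N}$. *)

(* Defs.v *)
From HB Require Import structures.
From Stdlib Require Lists.List.
From mathcomp Require Import all_boot all_order all_algebra all_classical topology.
Set Implicit Arguments. Unset Strict Implicit. Unset Printing Implicit Defensive.
Import GRing.Theory.
Local Open Scope classical_set_scope.
Local Open Scope ring_scope.

Section InvSemigroup.
Variables (S : Type) (mul : S -> S -> S) (star : S -> S).

Definition inverse_semigroup : Prop :=
  [/\ (forall a b c, mul a (mul b c) = mul (mul a b) c),
      (forall s, mul (mul s (star s)) s = s /\ mul (mul (star s) s) (star s) = star s)
    & (forall s t, mul (mul s t) s = s -> mul (mul t s) t = t -> t = star s)].

Definition idempotent (e : S) : Prop := mul e e = e.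

Definition isle (s t : S) : Prop := s = mul t (mul (star s) s).
End InvSemigroup.

Section PartialAction.
Variables (S : Type) (mul : S -> S -> S) (star : S -> S).
Variables (X : topologicalType) (Xs : S -> set X) (th : S -> X -> X).

(* theta_s : X_{s^star} -> X_s is represented by the total function th s,
   only its restriction to Xs (star s) being meaningful. *)
Definition top_partial_action : Prop :=
  (forall s, open (Xs s)) /\
  (forall s, {within Xs (star s), continuous (th s)}) /\
  (forall s, [set th s x | x in Xs (star s)] = Xs s) /\
  (* phi(s^star) = phi(s)^star : theta_{s^star} is the inverse partial bijection *)
  (forall s, Xs (star (star s)) = Xs s) /\
  (forall s x, Xs (star s) x -> th (star s) (th s x) = x) /\
  (* phi(s) phi(t) <= phi(st) *)
  (forall s t x, Xs (star t) x -> Xs (star s) (th t x) ->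
      Xs (star (mul s t)) x /\ th (mul s t) x = th s (th t x)) /\
  (forall s t, isle mul star s t ->
      Xs (star s) `<=` Xs (star t) /\ (forall x, Xs (star s) x -> th s x = th t x)) /\
  (forall x : X, exists e, idempotent mul e /\ Xs e x).
End PartialAction.

Section Germs.
Variables (S : Type) (mul : S -> S -> S) (star : S -> S).
Variables (X : topologicalType) (Xs : S -> set X) (th : S -> X -> X).
Variable (R : comPzRingType).

Definition germeq (s : S) (x : X) (t : S) (y : X) : Prop :=
  x = y /\ exists u, [/\ isle mul star u s, isle mul star u t & Xs (star u) x].

(* A subset of the set of germs, represented as a predicate on S * X
   contained in S*X and saturated for ~. *)
Definition germset := S -> X -> Prop.

Definition is_germset (B : germset) : Prop :=
  (forall s x, B s x -> Xs (star s) x) /\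
  (forall s x t y, Xs (star t) y -> germeq s x t y -> B s x -> B t y).

(* basic open set [t,U] = { [t,x] : x in U } *)
Definition basic (t : S) (U : set X) : germset :=
  fun s x => [/\ Xs (star s) x, U x & germeq s x t x].

Definition gopen (B : germset) : Prop :=
  is_germset B /\
  forall s x, B s x -> exists t (U : set X),
    [/\ open U, U `<=` Xs (star t), basic t U s x
      & forall s' y, basic t U s' y -> B s' y].

Definition gcompact (B : germset) : Prop :=
  forall (I : Type) (V : I -> germset), (forall i, gopen (V i)) ->
    (forall s x, B s x -> exists i, V i s x) ->
    exists l : seq I, forall s x, B s x -> exists i, Stdlib.Lists.List.In i l /\ V i s x.

(* source [s,x] = x, range [s,x] = theta_s x, both injective on B *)
Definition gbisection (B : germset) : Prop :=
  forall s x t y, B s x -> B t y ->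
    (x = y -> germeq s x t y) /\ (th s x = th t y -> germeq s x t y).

Definition compact_open_bisection (B : germset) : Prop :=
  [/\ gopen B, gcompact B & gbisection B].

(* R-valued functions on the germs: f s x is the value at [s,x]
   (and f s x = 0 when (s,x) is not in S*X). *)
Definition germfun := S -> X -> R.

Definition in_steinberg (f : germfun) : Prop :=
  exists l : seq (R * germset),
    (forall p, Stdlib.Lists.List.In p l -> compact_open_bisection p.2) /\
    forall s x, f s x =
      if `[< Xs (star s) x >] then
        \sum_(p <- l) (if `[< p.2 s x >] then p.1 else 0)
      else 0.

Definition gadd (f g : germfun) : germfun := fun s x => f s x + g s x.
Definition gscale (r : R) (f : germfun) : germfun := fun s x => r * f s x.

(* pairs of germs ([s, th t x], [t, x]) are equal *)
Definition same_pair (x : X) (p q : S * S) : Prop :=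
  germeq p.2 x q.2 x /\ germeq p.1 (th p.2 x) q.1 (th q.2 x).

(* h = f * g (convolution): h(a) = sum_{bc = a} f(b) g(c), a finite sum.
   For a = [u,x], the pairs (b,c) with bc = a are b = [s, th t x], c = [t,x]
   with [st,x] = [u,x]; l enumerates such pairs without repetition and
   contains every pair with nonzero contribution. *)
Definition conv (f g h : germfun) : Prop :=
  (forall u x, ~ Xs (star u) x -> h u x = 0) /\
  forall u x, Xs (star u) x ->
    exists l : seq (S * S),
    [/\ (forall p, Stdlib.Lists.List.In p l ->
           [/\ Xs (star p.2) x, Xs (star p.1) (th p.2 x)
             & germeq (mul p.1 p.2) x u x]),
        pairwise (fun p q => `[< ~ same_pair x p q >]) l,
        (forall s t, Xs (star t) x -> Xs (star s) (th t x) ->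
           germeq (mul s t) x u x -> f s (th t x) * g t x != 0 ->
           exists p, Stdlib.Lists.List.In p l /\ same_pair x (s, t) p)
      & h u x = \sum_(p <- l) f p.1 (th p.2 x) * g p.2 x].

Definition loc_const (f : X -> R) : Prop :=
  forall x, exists U : set X, [/\ open U, U x & forall y, U y -> f y = f x].

Definition in_AX (f : X -> R) : Prop :=
  loc_const f /\ compact (closure [set x | f x != 0]).

Definition inD (s : S) (f : X -> R) : Prop :=
  in_AX f /\ [set x | f x != 0] `<=` Xs s.

Definition alpha (s : S) (f : X -> R) : X -> R :=
  fun x => if `[< Xs s x >] then f (th (star s) x) else 0.

(* elements of L are finite formal sums  sum a_s delta_s, represented by
   lists of pairs (s, a_s) with a_s in D_s; coef computes the coefficient
   of delta_u (so two lists denote the same element of L iff their coef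
   agree). *)
Definition formal := seq (S * (X -> R)).

Definition valid (l : formal) : Prop := forall p, Stdlib.Lists.List.In p l -> inD p.1 p.2.

Definition coef (l : formal) : S -> X -> R :=
  fun u x => \sum_(p <- l) (if `[< p.1 = u >] then p.2 x else 0).

Definition mulL (l1 l2 : formal) : formal :=
  [seq (mul p.1 q.1, alpha p.1 (fun y => alpha (star p.1) p.2 y * q.2 y))
  | p <- l1, q <- l2].

(* c lies in N: the additive subgroup generated by a delta_r - a delta_s,
   r <= s, a in D_r (closed under negation, so it consists of finite sums
   of generators). *)
Definition inN (c : S -> X -> R) : Prop :=
  exists l : seq (S * S * (X -> R)),
    (forall p, Stdlib.Lists.List.In p l -> isle mul star p.1.1 p.1.2 /\ inD p.1.1 p.2) /\
    c = fun u x => \sum_(p <- l)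
          ((if `[< p.1.1 = u >] then p.2 x else 0) -
           (if `[< p.1.2 = u >] then p.2 x else 0)).

Definition cdiff (c d : S -> X -> R) : S -> X -> R := fun u x => c u x - d u x.

(* A_R(S |x X) is isomorphic, as an R-algebra, to L / N = A_R(X) x|_alpha S:
   Phi maps A_R(S|xX) into L and induces a bijective R-algebra map to L/N. *)
Definition steinberg_crossed_iso : Prop :=
  (forall f g, in_steinberg f -> in_steinberg g ->
     exists h, in_steinberg h /\ conv f g h) /\
  exists Phi : germfun -> formal,
    (forall f, in_steinberg f -> valid (Phi f)) /\
    (forall f g, in_steinberg f -> in_steinberg g ->
        inN (cdiff (coef (Phi (gadd f g))) (fun u x => coef (Phi f) u x + coef (Phi g) u x))) /\
    (forall r f, in_steinberg f ->
        inN (cdiff (coef (Phi (gscale r f))) (fun u x => r * coef (Phi f) u x))) /\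
    (forall f g h, in_steinberg f -> in_steinberg g -> in_steinberg h -> conv f g h ->
        inN (cdiff (coef (Phi h)) (coef (mulL (Phi f) (Phi g))))) /\
    (forall f g, in_steinberg f -> in_steinberg g ->
        inN (cdiff (coef (Phi f)) (coef (Phi g))) -> f = g) /\
    (forall l, valid l -> exists f, in_steinberg f /\ inN (cdiff (coef (Phi f)) (coef l))).

End Germs.

(* Main.v *)
(* A formal sum [sum a_s delta_s] defines the function on germs whose value at [[t,x]]
   is the sum of [a_s (theta_s x)] over the s with [[s,x] = [t,x]]. This map [Psi] is
   multiplicative, kills N, and its image is the Steinberg algebra, because a
   compact-open bisection is a finite disjoint union of basic slices [[s,W]] with W
   compact open. If [Psi l = 0], then near any x the terms of l sharing a germ at x can
   be moved modulo N onto a common lower bound, where their coefficients add up to 0;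
   compactness of the supports and a finite disjoint clopen cover give [l] in N. *)
From Stdlib Require Lists.List.
Require Import Defs.
From mathcomp Require Import all_boot all_order all_algebra all_classical topology ring.
Set Implicit Arguments. Unset Strict Implicit. Unset Printing Implicit Defensive.
Import GRing.Theory.
Local Open Scope classical_set_scope.

(** [Psi] goes from formal sums to functions, whereas the isomorphism is stated through a map [Phi]
    in the other direction, with lists as values. So [Phi] merely chooses a preimage under [Psi];
    additivity, scalars, products and surjectivity then all reduce to [Psi_eq_inN]: lists with the
    same [Psi] have coefficients that differ by an element of N. The obstacle is this kernel.
    Vanishing of [Psi] is a pointwise condition on germs, while N is an additive group of
    coefficients without a local description, so relations found near each point can only be added
    up over disjoint pieces. For this reason all coefficients are read, and cut, at the source of a
    germ, where a single subset of X acts on every term at once. *)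

Section InverseSemigroupTheory.

(** * Inverse semigroups: commuting idempotents and the natural order *)

Variables (S : Type) (mul : S -> S -> S) (star : S -> S).
Hypothesis iS : inverse_semigroup mul star.

Local Notation "a '** b" := (mul a b) (at level 40, left associativity).
Local Notation idem := (Defs.idempotent mul).
Local Notation isle := (Defs.isle mul star).

Lemma isg_mulA a b c : a '** (b '** c) = a '** b '** c.
Proof. by case: iS. Qed.

Lemma isg_mulVK s : s '** star s '** s = s.
Proof. by case: iS => _ /(_ s) []. Qed.

Lemma isg_mulKV s : star s '** s '** star s = star s.
Proof. by case: iS => _ /(_ s) []. Qed.

Lemma isg_star_uniq s t : s '** t '** s = s -> t '** s '** t = t -> t = star s.
Proof. by case: iS => _ _; exact. Qed.

Lemma isg_starK s : star (star s) = s.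
Proof. by symmetry; apply: isg_star_uniq; [exact: isg_mulKV|exact: isg_mulVK]. Qed.

Lemma isg_star_idem e : idem e -> star e = e.
Proof. by move=> ee; symmetry; apply: isg_star_uniq; rewrite !ee. Qed.

Lemma idem_starM s : idem (star s '** s).
Proof. by rewrite /idem isg_mulA isg_mulKV. Qed.

(* If x is the inverse of ef then fxe is also one, hence x = fxe is idempotent. *)
Lemma idemM e f : idem e -> idem f -> idem (e '** f).
Proof.
move=> ee ff; set x := star (e '** f).
have xE : f '** x '** e = x.
  apply: isg_star_uniq.
    rewrite -[RHS]isg_mulVK -/x !isg_mulA.
    by rewrite -(isg_mulA e f f) ff -(isg_mulA _ e e) ee.
  transitivity (f '** (x '** (e '** e) '** (f '** f) '** x) '** e).
    by rewrite !isg_mulA.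
  by rewrite ee ff -(isg_mulA x e f) isg_mulKV.
have xx : idem x.
  rewrite /idem -{1}xE -{2}xE.
  transitivity (f '** (x '** (e '** f) '** x) '** e); first by rewrite !isg_mulA.
  by rewrite isg_mulKV xE.
by rewrite -(isg_starK (e '** f)) (isg_star_idem xx).
Qed.

(** By [idemM] both products are idempotent. An idempotent is its own inverse, and [ef] is an
    inverse of [fe]. *)
Lemma idemC e f : idem e -> idem f -> e '** f = f '** e.
Proof.
move=> ee ff; have ef := idemM ee ff; have fe := idemM ff ee.
have := @isg_star_uniq (f '** e) (e '** f); rewrite (isg_star_idem fe); apply.
- by rewrite !isg_mulA -(isg_mulA f e e) ee -(isg_mulA _ f f) ff -isg_mulA.
- by rewrite !isg_mulA -(isg_mulA e f f) ff -(isg_mulA _ e e) ee -isg_mulA.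
Qed.

Lemma isg_starM s t : star (s '** t) = star t '** star s.
Proof.
have sE := idem_starM s; have tE := idem_starM (star t); rewrite isg_starK in tE.
symmetry; apply: isg_star_uniq.
  transitivity (s '** ((t '** star t) '** (star s '** s)) '** t).
    by rewrite !isg_mulA.
  by rewrite (idemC tE sE) !isg_mulA isg_mulVK -!isg_mulA (isg_mulA t) isg_mulVK.
transitivity (star t '** ((star s '** s) '** (t '** star t)) '** star s).
  by rewrite !isg_mulA.
by rewrite -(idemC tE sE) !isg_mulA isg_mulKV -!isg_mulA (isg_mulA (star s)) isg_mulKV.
Qed.

Lemma isle_mulr t e : idem e -> isle (t '** e) t.
Proof.
move=> ee; rewrite /Defs.isle isg_starM (isg_star_idem ee).
transitivity (t '** (e '** (star t '** t)) '** e); last by rewrite !isg_mulA.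
by rewrite (idemC ee (idem_starM t)) !isg_mulA isg_mulVK -isg_mulA ee.
Qed.

Lemma isle_refl s : isle s s.
Proof. by rewrite /Defs.isle isg_mulA isg_mulVK. Qed.

Lemma isle_trans t s r : isle s t -> isle t r -> isle s r.
Proof.
move=> st tr; rewrite st tr -isg_mulA; apply: isle_mulr.
by apply: idemM; apply: idem_starM.
Qed.

Lemma idem_conj e t : idem e -> idem (star t '** e '** t).
Proof.
move=> ee; rewrite /idem.
transitivity (star t '** (e '** (t '** star t)) '** e '** t).
  by rewrite !isg_mulA.
rewrite (idemC ee); last by have := idem_starM (star t); rewrite isg_starK.
by rewrite !isg_mulA isg_mulKV -(isg_mulA _ e e) ee.
Qed.

(** An idempotent can cross t at the price of a conjugation; in [isle_mul] this collects all
    idempotents on the right of a product. *)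
Lemma idem_mull e t : idem e -> e '** t = t '** (star t '** e '** t).
Proof.
move=> ee; transitivity ((t '** star t '** e) '** t); last by rewrite !isg_mulA.
rewrite -(idemC ee); last by have := idem_starM (star t); rewrite isg_starK.
by rewrite -!isg_mulA (isg_mulA t) isg_mulVK.
Qed.

Lemma isle_mul u s v t : isle u s -> isle v t -> isle (u '** v) (s '** t).
Proof.
have gen e f : idem e -> idem f -> isle (s '** e '** (t '** f)) (s '** t).
  move=> ee ff; rewrite (_ : _ '** _ = s '** t '** (star t '** e '** t '** f)).
    by apply: isle_mulr; apply: idemM => //; apply: idem_conj.
  transitivity (s '** (e '** t) '** f); first by rewrite !isg_mulA.
  by rewrite (idem_mull t ee) !isg_mulA.
by move=> us vt; rewrite us vt; apply: gen; exact: idem_starM.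
Qed.

(** Below a common t, both elements are restrictions of t, and cutting u down to the domain
    idempotent of v gives a common lower bound. Transitivity of germ equality rests on this. *)
Lemma isle_meet u v t : isle u t -> isle v t ->
  isle (u '** (star v '** v)) u /\ isle (u '** (star v '** v)) v.
Proof.
move=> ut vt; split; first by apply: isle_mulr; apply: idem_starM.
rewrite {1}ut -isg_mulA (idemC (idem_starM u) (idem_starM v)) isg_mulA -vt.
by apply: isle_mulr; apply: idem_starM.
Qed.

End InverseSemigroupTheory.

(** * Compact open sets and gluing over disjoint covers *)

Section CompactOpen.
Variable X : topologicalType.

(** Compactness is given by cluster points of filters. If no finite subfamily covered K, the traces
    on K of complements of finite unions would generate a proper filter, whose cluster point lies in
    some [O i] although the complement of [O i] is in the filter. *)
Lemma compact_seq_cover (K : set X) (I : Type) (O : I -> set X) : compact K ->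
  (forall i, open (O i)) -> (forall x, K x -> exists i, O i x) ->
  exists l : seq I, forall x, K x -> exists i, List.In i l /\ O i x.
Proof.
move=> cK oO KO; apply: contrapT => nl.
pose F := [set B | exists l : seq I,
  forall x, K x -> (forall i, List.In i l -> ~ O i x) -> B x].
have FP : ProperFilter F.
  split.
    case=> l lP; apply: nl; exists l => x Kx; apply: contrapT => nx.
    by apply: (lP x Kx) => i il Oix; apply: nx; exists i.
  split.
  - by exists [::].
  - move=> A B [l1 l1P] [l2 l2P]; exists (l1 ++ l2) => x Kx xP; split.
      by apply: l1P => // i il; apply: xP; apply: List.in_or_app; left.
    by apply: l2P => // i il; apply: xP; apply: List.in_or_app; right.
  - by move=> A B AB [l lP]; exists l => x Kx xP; apply: AB; apply: lP.
have FK : F K by exists [::].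
have [a [Ka ca]] := cK F FP FK.
have [i Oia] := KO _ Ka.
have [|b [] //] := ca (~` O i) (O i) _ (open_nbhs_nbhs (conj (oO i) Oia)).
by exists [:: i] => x _ /(_ i); apply; left.
Qed.

Hypothesis hX : hausdorff_space X.

Definition copen (W : set X) := open W /\ compact W.

Lemma copen0 : copen set0.
Proof. by split; [exact: open0|exact: compact0]. Qed.

Lemma copenU W W' : copen W -> copen W' -> copen (W `|` W').
Proof. by case=> oW cW [oW' cW']; split; [exact: openU|exact: compactU]. Qed.

Lemma copenD W W' : copen W -> copen W' -> copen (W `&` ~` W').
Proof.
case=> oW cW [oW' cW']; split.
  by apply: openI => //; apply: closed_openC; apply: compact_closed.
apply: (subclosed_compact _ cW); last by move=> ? [].
by apply: closedI; [exact: compact_closed|exact: open_closedC].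
Qed.

Lemma copenI W W' : copen W -> copen W' -> copen (W `&` W').
Proof.
case=> oW cW [oW' cW']; split; first exact: openI.
apply: (subclosed_compact _ cW); last by move=> ? [].
by apply: closedI; exact: compact_closed.
Qed.

Hypotheses (lcX : locally_compact [set: X]) (zX : zero_dimensional X).

(** Let V be the part of U interior to a compact neighbourhood K of x. Clopen sets separate x from
    the points of the compact set K minus V; finitely many suffice, and their intersection D
    satisfies [D]&[K = D]&[V], which is compact by the left side and open by the right. *)
Lemma copen_basis x (U : set X) : open U -> U x ->
  exists W, [/\ copen W, W x & W `<=` U].
Proof.
move=> oU Ux.
have [K xK [cK clK]] : compact_near (nbhs x).
  by have := @lcX x Logic.I; rewrite withinET.
pose V := K° `&` U.
have oV : open V by apply: openI => //; exact: open_interior.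
have cKV : compact (K `&` ~` V).
  apply: (subclosed_compact _ cK); last by move=> ? [].
  by apply: closedI => //; exact: open_closedC.
have [|y [Ky nVy]|l lP] := @compact_seq_cover _
    {C : set X | clopen C /\ C x} (fun C => ~` sval C) cKV.
- by move=> [C [[oC cC] Cx]] /=; exact: closed_openC.
- have xy : x != y by apply/eqP => xy; apply: nVy; rewrite -xy; split.
  by have [C [clC Cx nCy]] := zX xy; exists (exist _ C (conj clC Cx)).
pose D := [set y | forall C, List.In C l -> sval C y].
have [clD Dx] : clopen D /\ D x.
  rewrite {}/D; elim: l {lP} => [|C l [IH IHx]].
    split; last by move=> ? [].
    by rewrite (_ : [set y | _] = setT);
      [exact: clopenT|apply/seteqP; split=> // y _ ? []].
  split; last by move=> C' [<-|/IHx//]; case: (svalP C).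
  rewrite (_ : [set y | _] =
    sval C `&` [set y | forall C, List.In C l -> sval C y]).
    by apply: clopenI => //; case: (svalP C).
  apply/seteqP; split=> y.
    by move=> H; split; [apply: H; left|move=> C' C'l; apply: H; right].
  by move=> [Cy H] C' [<-//|/H].
have DK : D `&` K = D `&` V.
  apply/seteqP; split=> y [Dy].
    move=> Ky; split=> //; apply: contrapT => nV.
    by have [C [Cl]] := lP y (conj Ky nV); apply; apply: Dy.
  by case=> /interior_subset Ky _; split.
exists (D `&` V); split.
- split; first by case: clD => oD _; exact: openI.
  rewrite -DK; apply: (subclosed_compact _ cK); last by move=> ? [].
  by case: clD => _ cD; exact: closedI.
- by split=> //; split.
- by move=> y [_ []].
Qed.

(* Asking P of all smaller compact open sets lets a finite cover be made disjoint. *)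
Definition hcopen (P : set X -> Prop) (W : set X) :=
  copen W /\ forall W', copen W' -> W' `<=` W -> P W'.

Variable P : set X -> Prop.
Hypothesis P0 : P set0.
Hypothesis PU : forall W W', copen W -> copen W' ->
  (forall x, W x -> ~ W' x) -> P W -> P W' -> P (W `|` W').

Lemma hcopenU W W' : hcopen P W -> hcopen P W' -> hcopen P (W `|` W').
Proof.
case=> cW PW [cW' PW']; split; first exact: copenU.
(* The overlap is assigned to W, so that the two pieces of V are disjoint and [PU] applies. *)
move=> V cV VW; rewrite (_ : V = (V `&` W) `|` (V `&` ~` W)); last first.
  by rewrite -setIUr setUCr setIT.
apply: PU; [exact: copenI|exact: copenD| | | ].
- by move=> x [_ Wx] [_ ].
- by apply: PW; [exact: copenI|move=> ? []].
- by apply: PW'; [exact: copenD|move=> x [/VW[]]].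
Qed.

Lemma hcopen_seq (I : Type) (O : I -> set X) (l : seq I) :
  (forall i, List.In i l -> hcopen P (O i)) ->
  hcopen P [set x | exists i, List.In i l /\ O i x].
Proof.
elim: l => [|i l IH] H.
  have -> : [set x | exists i, List.In i [::] /\ O i x] = set0.
    by apply/seteqP; split=> // x [i [[]]].
  by split; [exact: copen0|move=> W _; rewrite subset0 => ->].
rewrite (_ : [set x | _] = O i `|` [set x | exists i, List.In i l /\ O i x]).
  by apply: hcopenU; [apply: H; left|apply: IH => j jl; apply: H; right].
apply/seteqP; split=> x.
  by move=> [j [[<-|jl] Ox]]; [left|right; exists j].
by move=> [Ox|[j [jl Ox]]]; [exists i; split=> //; left|exists j; split=> //; right].
Qed.

Lemma hcopen_cover (K : set X) : compact K ->
  (forall x, K x -> exists W, W x /\ hcopen P W) ->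
  exists W, K `<=` W /\ hcopen P W.
Proof.
move=> cK KP.
have [|x Kx|l lP] := @compact_seq_cover K {W | hcopen P W} sval cK.
- by move=> [W [[oW cW] PW]].
- by have [W [Wx PW]] := KP x Kx; exists (exist _ W PW).
exists [set x | exists i, List.In i l /\ sval i x]; split=> //.
by apply: hcopen_seq => i _; exact: svalP.
Qed.

End CompactOpen.

(** * Partial actions and equality of germs *)

Section PartialActionTheory.
Local Open Scope ring_scope.
Variables (R : comPzRingType) (S : Type) (mul : S -> S -> S) (star : S -> S).
Variables (X : topologicalType) (Xs : S -> set X) (th : S -> X -> X).
Hypotheses (iS : inverse_semigroup mul star) (hX : hausdorff_space X).
Hypotheses (lcX : locally_compact [set: X]) (zX : zero_dimensional X).
Hypothesis pa : top_partial_action mul star Xs th.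

Local Notation isle := (Defs.isle mul star).
Local Notation germeq := (Defs.germeq mul star Xs).
Local Notation alpha := (@Defs.alpha S star X Xs th R).
Local Notation inD := (@Defs.inD S X Xs R).
Local Notation loc_const := (@Defs.loc_const X R).
Local Notation basic := (Defs.basic mul star Xs).
Local Notation steinberg := (@in_steinberg S mul star X Xs th R).
Local Notation valid := (@Defs.valid S X Xs R).
Local Notation coef := (@Defs.coef S X R).
Local Notation inN := (@Defs.inN S mul star X Xs R).
Local Notation mulL := (@Defs.mulL S mul star X Xs th R).
Local Notation formal := (@Defs.formal S X R).
Local Notation conv := (@Defs.conv S mul star X Xs th R).
Local Notation supp f := [set x | f x != 0].
Local Notation starK := (isg_starK iS).

Lemma Xs_open s : open (Xs s). Proof. by case: pa. Qed.

Lemma th_cont s : {within Xs (star s), continuous (th s)}.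
Proof. by case: pa => _ [/(_ s)]. Qed.

Lemma th_in s x : Xs (star s) x -> Xs s (th s x).
Proof. by case: pa => _ [_ [/(_ s) H _]] sx; rewrite -H; exists x. Qed.

Lemma thK s x : Xs (star s) x -> th (star s) (th s x) = x.
Proof. by case: pa => _ [_ [_ [_ [H _]]]] /H. Qed.

Lemma th_inV s y : Xs s y -> Xs (star s) (th (star s) y).
Proof. by move=> sy; apply: th_in; rewrite starK. Qed.

Lemma thVK s y : Xs s y -> th s (th (star s) y) = y.
Proof. by move=> sy; have := @thK (star s) y; rewrite starK; apply. Qed.

Lemma th_inj s x y : Xs (star s) x -> Xs (star s) y -> th s x = th s y -> x = y.
Proof. by move=> sx sy xy; rewrite -(thK sx) xy thK. Qed.

Lemma thM s t x : Xs (star t) x -> Xs (star s) (th t x) ->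
  Xs (star (mul s t)) x /\ th (mul s t) x = th s (th t x).
Proof. by case: pa => _ [_ [_ [_ [_ [H _]]]]]; apply: H. Qed.

Lemma th_le u s x : isle u s -> Xs (star u) x -> Xs (star s) x /\ th u x = th s x.
Proof.
case: pa => _ [_ [_ [_ [_ [_ [H _]]]]]] us ux.
by have [us1 us2] := H _ _ us; split; [exact: us1|exact: us2].
Qed.

Lemma open_th s (U : set X) : open U -> open (Xs s `&` th (star s) @^-1` U).
Proof.
move=> oU; have := @th_cont (star s); rewrite starK.
rewrite continuous_open_subspace; last exact: Xs_open.
rewrite openE => H x [sx Ux]; apply: filterI.
  by apply: open_nbhs_nbhs; split=> //; exact: Xs_open.
by apply: H; [rewrite inE|apply: open_nbhs_nbhs].
Qed.

Lemma compact_th s (K : set X) : compact K -> K `<=` Xs (star s) ->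
  compact [set th s x | x in K].
Proof.
by move=> cK KX; apply: continuous_compact => //; apply: continuous_subspaceW (@th_cont s).
Qed.

Lemma germ_refl s x : Xs (star s) x -> germeq s x s x.
Proof. by move=> sx; split=> //; exists s; split=> //; exact: isle_refl. Qed.

Lemma germ_sym s x t y : germeq s x t y -> germeq t y s x.
Proof. by case=> <- [u [us ut ux]]; split=> //; exists u. Qed.

Lemma germ_trans s x t y r z : germeq s x t y -> germeq t y r z -> germeq s x r z.
Proof.
case=> <- [u [us ut ux]] [<- [v [vt vr vx]]]; split=> //.
have [wu wv] := isle_meet iS ut vt.
exists (mul u (mul (star v) v)); split.
- exact: (isle_trans iS wu).
- exact: (isle_trans iS wv).
(* The idempotent [mul (star v) v] fixes x, so x remains in the domain of u multiplied by it. *)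
have [vvx vvE] : Xs (star (mul (star v) v)) x /\ th (mul (star v) v) x = x.
  have [] := @thM (star v) v x vx; first by rewrite starK; exact: th_in.
  by rewrite thK.
by have [] := @thM u (mul (star v) v) x vvx; rewrite ?vvE.
Qed.

Lemma germ_dom s x t y : germeq s x t y -> Xs (star s) x.
Proof. by case=> _ [u [us _ ux]]; case: (th_le us ux). Qed.

Lemma germ_domr s x t y : germeq s x t y -> Xs (star t) y.
Proof. by move/germ_sym/germ_dom. Qed.

Lemma germ_th s x t y : germeq s x t y -> th s x = th t y.
Proof.
case=> <- [u [us ut ux]].
by have [_ <-] := th_le us ux; have [_ <-] := th_le ut ux.
Qed.

Lemma germ_le u s x : isle u s -> Xs (star u) x -> germeq u x s x.
Proof. by move=> us ux; split=> //; exists u; split=> //; exact: isle_refl. Qed.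

Lemma germ_mul s s' t t' x : germeq t x t' x ->
  germeq s (th t x) s' (th t' x) -> germeq (mul s t) x (mul s' t') x.
Proof.
move=> [_ [v [vt vt' vx]]] [_ [u [us us' ux]]]; split=> //.
exists (mul u v); split; [exact: isle_mul|exact: isle_mul|].
by have [] := @thM u v x vx; have [_ ->] := th_le vt vx.
Qed.

(** * Locally constant functions *)

Lemma loc_const_closed (f : X -> R) : loc_const f -> closed (supp f).
Proof.
move=> lf; rewrite -[supp f]setCK; apply: open_closedC; rewrite openE => x /= nx.
have [U [oU Ux Uf]] := lf x; apply: filterS (open_nbhs_nbhs (conj oU Ux)).
by move=> y Uy /=; rewrite Uf.
Qed.

Lemma inDP s (f : X -> R) :
  inD s f <-> [/\ loc_const f, compact (supp f) & supp f `<=` Xs s].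
Proof.
split.
  by case=> [[lf cf] sf]; split=> //; rewrite (closure_id (supp f)).1 //;
    exact: loc_const_closed.
by case=> lf cf sf; split=> //; split=> //; rewrite -(closure_id (supp f)).1 //;
  exact: loc_const_closed.
Qed.

Lemma loc_const_cst (c : R) : loc_const (fun=> c).
Proof. by move=> x; exists setT; split=> //; exact: openT. Qed.

Lemma loc_const_op2 (op : R -> R -> R) (f g : X -> R) :
  loc_const f -> loc_const g -> loc_const (fun x => op (f x) (g x)).
Proof.
move=> lf lg x; have [U [oU Ux Uf]] := lf x; have [V [oV Vx Vg]] := lg x.
exists (U `&` V); split=> //; first exact: openI.
by move=> y [Uy Vy]; rewrite Uf // Vg.
Qed.

Lemma inDS s t (f g : X -> R) : inD s f -> loc_const g -> supp g `<=` supp f ->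
  supp g `<=` Xs t -> inD t g.
Proof.
move/inDP => [lf cf sf] lg gf gt; apply/inDP; split=> //.
by apply: subclosed_compact gf => //; exact: loc_const_closed.
Qed.

Lemma inDZ s (r : R) (f : X -> R) : inD s f -> inD s (fun x => r * f x).
Proof.
move=> Df; have [lf cf sf] := (inDP s f).1 Df.
have sub : supp (fun x => r * f x) `<=` supp f.
  by move=> x /=; apply: contra_neq => ->; rewrite mulr0.
apply: (inDS Df _ sub) => [|x /sub/sf//].
exact: (loc_const_op2 (fun _ => *%R r) lf lf).
Qed.

Lemma inDN s (f : X -> R) : inD s f -> inD s (fun x => - f x).
Proof.
move=> Df; rewrite (_ : (fun x => _) = fun x => -1 * f x); first exact: inDZ.
by apply/funext => x; rewrite mulN1r.
Qed.

Definition cut (W : set X) (f : X -> R) : X -> R :=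
  fun x => if `[< W x >] then f x else 0.

Lemma cut_supp W f : supp (cut W f) `<=` W.
Proof. by move=> x /=; rewrite /cut; case: asboolP => // _; rewrite eqxx. Qed.

Lemma loc_const_cut W f : copen W -> loc_const f -> loc_const (cut W f).
Proof.
move=> [oW cW] lf x; have [U [oU Ux Uf]] := lf x; have [Wx|nWx] := pselect (W x).
  exists (U `&` W); split=> //; first exact: openI.
  by move=> y [Uy Wy]; rewrite /cut !asboolT // Uf.
exists (~` W); split=> //; first by apply: closed_openC; exact: compact_closed.
by move=> y nWy; rewrite /cut !asboolF.
Qed.

Lemma inD_cut s W f : copen W -> W `<=` Xs s -> loc_const f -> inD s (cut W f).
Proof.
move=> cW Ws lf; have lW := loc_const_cut cW lf; apply/inDP; split=> //.
  by apply: subclosed_compact (@cut_supp W f); [exact: loc_const_closed|case: cW].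
by move=> x /cut_supp/Ws.
Qed.

(** * The dual action *)

Lemma alpha_supp s f : supp (alpha s f) `<=` Xs s.
Proof. by move=> x /=; rewrite /Defs.alpha; case: asboolP => // _; rewrite eqxx. Qed.

Lemma alphaVE s f x : alpha (star s) f x = if `[< Xs (star s) x >] then f (th s x) else 0.
Proof. by rewrite /Defs.alpha starK. Qed.

Lemma alphaVK s f : supp f `<=` Xs s -> alpha s (alpha (star s) f) = f.
Proof.
move=> sf; apply/funext => x; rewrite {1}/Defs.alpha alphaVE; case: asboolP => sx.
  by rewrite asboolT; [rewrite thVK|exact: th_inV].
by apply/eqP; rewrite eq_sym; apply: contrapT => /negP/sf.
Qed.

Lemma alphaK s f : supp f `<=` Xs (star s) -> alpha (star s) (alpha s f) = f.
Proof. by move/alphaVK; rewrite starK. Qed.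

Lemma alphaD s f g : alpha s (fun x => f x + g x) = fun x => alpha s f x + alpha s g x.
Proof. by apply/funext => x; rewrite /Defs.alpha; case: asboolP; rewrite ?addr0. Qed.

Lemma alphaZ s r f : alpha s (fun x => r * f x) = fun x => r * alpha s f x.
Proof. by apply/funext => x; rewrite /Defs.alpha; case: asboolP; rewrite ?mulr0. Qed.

Lemma alpha0 s : alpha s (fun=> 0) = fun=> 0.
Proof. by apply/funext => x; rewrite /Defs.alpha if_same. Qed.

(** The two sides could only differ at a point of X_s outside X_u; a nonzero value there comes from
    a point of X_{u*}, where the two maps agree and land in X_u. *)
Lemma alpha_le u s f : isle u s -> supp f `<=` Xs (star u) -> alpha u f = alpha s f.
Proof.
move=> us sf; apply/funext => y; rewrite /Defs.alpha; case: asboolP => uy.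
  have ux := th_inV uy; have [sx E] := th_le us ux.
  have yE : y = th s (th (star u) y) by rewrite -E thVK.
  rewrite asboolT; last by rewrite yE; exact: th_in.
  by rewrite {2}yE thK.
case: asboolP => // sy; apply/eqP; rewrite eq_sym; apply: contrapT => /negP/sf ux.
by apply: uy; have [_ E] := th_le us ux; rewrite -(thVK sy) -E; exact: th_in.
Qed.

(** The support is the image of [supp f] under θ_s, hence compact and so closed. Its open complement
    gives local constancy at points outside X_s, where continuity of θ says nothing. *)
Lemma inD_alpha s f : inD (star s) f -> inD s (alpha s f).
Proof.
move=> /inDP[lf cf sf].
have E : supp (alpha s f) = [set th s x | x in supp f].
  apply/seteqP; split=> y /=.
    rewrite {1}/Defs.alpha; case: asboolP; rewrite ?eqxx // => sy fy.
    by exists (th (star s) y) => //; rewrite thVK.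
  case=> x fx <-; have sx := sf _ fx.
  by rewrite /Defs.alpha asboolT ?thK //; exact: th_in.
have cE : compact (supp (alpha s f)) by rewrite E; exact: compact_th.
apply/inDP; split=> //; last exact: alpha_supp.
move=> y; have [sy|nsy] := pselect (Xs s y).
  have [U [oU Uy Uf]] := lf (th (star s) y).
  exists (Xs s `&` th (star s) @^-1` U); split=> //; first exact: open_th.
  by move=> z [sz Uz]; rewrite /Defs.alpha !asboolT // Uf.
exists (~` supp (alpha s f)); split.
- by apply: closed_openC; exact: compact_closed.
- by move=> /alpha_supp.
move=> z /= /negP; rewrite negbK => /eqP ->.
by rewrite /Defs.alpha asboolF.
Qed.

Lemma inD_alphaV s f : inD s f -> inD (star s) (alpha (star s) f).
Proof. by move=> sf; apply: inD_alpha; rewrite starK. Qed.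

(** Read at the source, the twisted product of the crossed product becomes an ordinary product of
    values at θ_t x and x. This is the origin of the multiplicativity of [Psi]. *)
Lemma alphaM s t f g x : Xs (star (mul s t)) x -> supp g `<=` Xs t ->
  alpha (star (mul s t)) (alpha s (fun y => alpha (star s) f y * g y)) x =
  alpha (star s) f (th t x) * alpha (star t) g x.
Proof.
move=> stx sg; rewrite !alphaVE asboolT // {1}/Defs.alpha.
have [[tx sx]|nx] := pselect (Xs (star t) x /\ Xs (star s) (th t x)).
  have [_ ->] := thM tx sx; rewrite !asboolT //; last exact: th_in.
  by rewrite thK // alphaVE asboolT.
transitivity (0 : R); last first.
  case: asboolP => [sx|_]; last by rewrite mul0r.
  by case: asboolP => [tx|_]; [case: nx|rewrite mulr0].
(* A nonzero value puts w in X_t. Then θ_st sends both x and θ_{t*} w to θ_s w, so they coincide and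
   x lies in the domain of the composite after all. *)
case: asboolP => // sz; set w := th (star s) _.
apply/eqP; apply: contrapT => /negP fg; apply: nx.
have gw : g w != 0 by apply: contra_neq fg => ->; rewrite mulr0.
have tw := sg _ gw.
have sw : Xs (star s) w by exact: th_inV.
have [st'x E] : Xs (star (mul s t)) (th (star t) w) /\
    th (mul s t) (th (star t) w) = th s w.
  by have [] := @thM s t (th (star t) w) (th_inV tw); rewrite thVK.
have xE : x = th (star t) w.
  by apply: (th_inj stx st'x); rewrite E /w thVK.
by rewrite xE thVK //; split=> //; exact: th_inV.
Qed.

Lemma inD_mulL s t f g : inD s f -> inD t g ->
  inD (mul s t) (alpha s (fun y => alpha (star s) f y * g y)).
Proof.
move=> Df Dg; have [lf cf sf] := (inDP _ _).1 (inD_alphaV Df).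
have [lg cg sg] := (inDP _ _).1 Dg.
have sub : supp (fun y => alpha (star s) f y * g y) `<=` supp (alpha (star s) f).
  by move=> x /=; apply: contra_neq => ->; rewrite mul0r.
have D : inD s (alpha s (fun y => alpha (star s) f y * g y)).
  apply/inD_alpha/(inDS (inD_alphaV Df)) => //; first exact: loc_const_op2.
  by move=> x /sub/sf.
have [lh ch sh] := (inDP _ _).1 D.
(* Membership in D_s is known; a support point y is θ_s w with w in X_t, hence the image of θ_{t*} w
   under θ_st. *)
apply: (inDS D) => // y; rewrite /= {1}/Defs.alpha; case: asboolP; rewrite ?eqxx //.
move=> sy fgy; set w := th (star s) y in fgy *.
have gw : g w != 0 by apply: contra_neq fgy => ->; rewrite mulr0.
have tw := sg _ gw.
have [] := @thM s t (th (star t) w) (th_inV tw).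
  by rewrite thVK //; exact: th_inV.
rewrite thVK // => /th_in + E; rewrite E.
by rewrite /w thVK.
Qed.

(** * From formal sums to functions on germs *)

Lemma eq_big_In (T : Type) (l : seq T) (F G : T -> R) :
  (forall p, List.In p l -> F p = G p) -> \sum_(p <- l) F p = \sum_(p <- l) G p.
Proof.
elim: l => [|p l IH] H; first by rewrite !big_nil.
rewrite !big_cons H; last by left.
by rewrite IH // => q ql; apply: H; right.
Qed.

Lemma In_map (T U : Type) (f : T -> U) (l : seq T) q :
  List.In q (map f l) -> exists2 p, List.In p l & q = f p.
Proof.
elim: l => [[]|p l IH /= [<-|/IH[r rl ->]]]; first by exists p => //; left.
by exists r => //; right.
Qed.

(** A coefficient lives on the range side X_s. Pulling it back by [alpha (star s)] makes it a
    locally constant function on all of X, vanishing off X_{s*}, so that terms with different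
    indices can be compared at x. *)
Definition Psi (l : formal) : S -> X -> R := fun t x =>
  \sum_(p <- l) (if `[< germeq t x p.1 x >] then alpha (star p.1) p.2 x else 0).

Lemma Psi_cat l l' t x : Psi (l ++ l') t x = Psi l t x + Psi l' t x.
Proof. by rewrite /Psi big_cat. Qed.

Lemma coef_cat l l' u x : coef (l ++ l') u x = coef l u x + coef l' u x.
Proof. by rewrite /Defs.coef big_cat. Qed.

Lemma valid_cat l l' : valid l -> valid l' -> valid (l ++ l').
Proof. by move=> vl vl' p pl; case: (List.in_app_or l l' p pl) => ?; [exact: vl|exact: vl']. Qed.

Definition scaleL (r : R) (l : formal) : formal :=
  [seq (p.1, fun x => r * p.2 x) | p <- l].

Lemma Psi_scale r l t x : Psi (scaleL r l) t x = r * Psi l t x.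
Proof.
rewrite /Psi big_map mulr_sumr; apply: eq_bigr => p _ /=.
by rewrite alphaZ; case: ifP; rewrite ?mulr0.
Qed.

Lemma coef_scale r l u x : coef (scaleL r l) u x = r * coef l u x.
Proof.
rewrite /Defs.coef big_map mulr_sumr; apply: eq_bigr => p _ /=.
by case: ifP; rewrite ?mulr0.
Qed.

Lemma valid_scale r l : valid l -> valid (scaleL r l).
Proof. by move=> vl p pl; have [q ql ->] := In_map pl; apply: inDZ; exact: vl. Qed.

Lemma valid_mulL l l' : valid l -> valid l' -> valid (mulL l l').
Proof.
rewrite /Defs.mulL; elim: l => [_ _ p []//|p l IH vl vl'] /=; apply: valid_cat.
  move=> r rl; have [q ql ->] := In_map rl; apply: inD_mulL; last exact: vl'.
  by apply: vl; left.
by apply: IH => // q ql; apply: vl; right.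
Qed.

Lemma Psi_germ l s x t y : germeq s x t y -> Psi l s x = Psi l t y.
Proof.
move=> st; have [xy _] := st; rewrite -{}xy in st *.
apply: eq_bigr => p _; congr (if _ then _ else _).
by apply/asbool_equiv_eq; split; apply: germ_trans => //; exact: germ_sym.
Qed.

(* Evaluation at a point y s depending only on s factors through [coef]. *)
Lemma coef0_sum (phi : S -> bool) (y : S -> X) (l : formal) :
  coef l = (fun _ _ => 0) ->
  \sum_(p <- l) (if phi p.1 then p.2 (y p.1) else 0) = 0.
Proof.
have [n] := ubnP (size l); elim: n l => // n IH [|[s a] l] szl cl.
  by rewrite big_nil.
set L := _ :: l in cl *.
(* All terms with the index of the head are removed together: at the single point [y s] they add up
   to a coefficient, which is 0. *)
rewrite (bigID (fun p => `[< p.1 = s >])) /=.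
rewrite (_ : \sum_(p <- L | `[< p.1 = s >]) _ = 0) ?add0r; last first.
  transitivity (if phi s then coef L s (y s) else 0); last by rewrite cl if_same.
  rewrite /Defs.coef big_mkcond; case: ifP => ps.
    by apply: eq_bigr => p _; case: asboolP => // ->; rewrite ps.
  by rewrite big1 // => p _; case: asboolP => // ->; rewrite ps.
rewrite -big_filter; apply: IH.
  rewrite /L /= asboolT //=; apply: leq_ltn_trans (szl : (size l < n)%N).
  by rewrite size_filter count_size.
apply/funext => u; apply/funext => x; rewrite /Defs.coef big_filter.
have [->|us] := pselect (u = s).
  by rewrite big1 // => p; case: asboolP.
transitivity (coef L u x); last by rewrite cl.
rewrite /Defs.coef big_mkcond; apply: eq_bigr => p _.
by case: asboolP => //= ->; rewrite asboolF // => /esym.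
Qed.

Lemma PsiE l t x : Psi l t x =
  \sum_(p <- l) (if `[< germeq t x p.1 x >] then p.2 (th p.1 x) else 0).
Proof.
apply: eq_bigr => p _; case: asboolP => // tp.
by rewrite alphaVE asboolT //; exact: germ_domr tp.
Qed.

Lemma Psi_inN l t x : inN (coef l) -> Psi l t x = 0.
Proof.
case=> L [LP cl].
(* The list of opposite generators: together with l it has zero coefficients, so by [coef0_sum] only
   [Psi gl] remains to be killed. *)
pose gl : formal := [seq (p.1.2, p.2) | p <- L] ++ scaleL (-1) [seq (p.1.1, p.2) | p <- L].
have c0 : coef (l ++ gl) = (fun _ _ => 0).
  apply/funext => u; apply/funext => y.
  rewrite !coef_cat cl coef_scale /Defs.coef !big_map sumrB /= mulN1r.
  by rewrite addrA subrK subrr.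
have := coef0_sum (fun s => `[< germeq t x s x >]) (fun s => th s x) c0.
rewrite -PsiE !Psi_cat Psi_scale mulN1r /Psi !big_map -sumrB /=.
rewrite [X in _ + X](eq_big_In (G := fun=> 0)); first by rewrite big1_eq addr0.
move=> [[r s] a] /LP[/= rs Da]; have [_ _ sa] := (inDP _ _).1 Da.
have sb := @alpha_supp (star r) a.
(* As [a] is supported in X_r, pulling it back along s or r gives the same function. Where it is
   nonzero, [s,x] = [r,x], so each generator contributes 0. *)
have E : alpha (star s) a = alpha (star r) a.
  rewrite -{1}(alphaVK sa) (alpha_le rs sb) alphaK // => z /sb rz.
  by have [] := th_le rs rz.
rewrite E; have [->|bx] := eqVneq (alpha (star r) a x) 0; first by rewrite !if_same subr0.
rewrite (_ : `[< germeq t x s x >] = `[< germeq t x r x >]) ?subrr //.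
have grs := germ_le rs (sb _ bx).
apply/asbool_equiv_eq; split=> H; apply: germ_trans H _ => //; exact: germ_sym.
Qed.

(** * The kernel *)

Lemma inN0 : inN (fun _ _ => 0).
Proof.
exists [::]; split; first by move=> ? [].
by apply/funext => u; apply/funext => x; rewrite big_nil.
Qed.

Lemma inN_add c d : inN c -> inN d -> inN (fun u x => c u x + d u x).
Proof.
case=> l [lP ->] [l' [lP' ->]]; exists (l ++ l'); split.
  by move=> p pl; case: (List.in_app_or l l' p pl) => [/lP|/lP'].
by apply/funext => u; apply/funext => x; rewrite big_cat.
Qed.

Lemma inN_gen r s a : isle r s -> inD r a ->
  inN (fun u x => (if `[< s = u >] then a x else 0) - (if `[< r = u >] then a x else 0)).
Proof.
move=> rs Da; exists [:: (r, s, fun x => - a x)]; split.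
  by move=> _ [<-|[]] /=; split=> //; exact: inDN.
apply/funext => u; apply/funext => x; rewrite big_seq1 /=.
by case: asboolP; case: asboolP; rewrite ?subr0 ?sub0r ?opprK // addrC.
Qed.

(** The cut is made on the source side: one W then treats all terms sharing a germ alike, whatever
    their indices. *)
Definition restrict (W : set X) (l : formal) : formal :=
  [seq (p.1, alpha p.1 (cut W (alpha (star p.1) p.2))) | p <- l].

Lemma coef_restrictU W W' l : (forall x, W x -> ~ W' x) ->
  coef (restrict (W `|` W') l) =
  fun u x => coef (restrict W l) u x + coef (restrict W' l) u x.
Proof.
move=> WW'; apply/funext => u; apply/funext => x.
rewrite /Defs.coef !big_map -big_split; apply: eq_bigr => p _ /=.
case: asboolP => _; last by rewrite addr0.
rewrite -[RHS]/((fun x => _ + _) x) -alphaD; congr (alpha _ _ x).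
apply/funext => y; rewrite /cut; case: (asboolP (W y)) => Wy.
  by rewrite asboolT ?asboolF ?addr0 //; [exact: WW'|left].
case: (asboolP (W' y)) => W'y; first by rewrite asboolT ?add0r //; right.
by rewrite asboolF ?addr0 // => -[].
Qed.

Lemma coef_restrict0 l : coef (restrict set0 l) = fun _ _ => 0.
Proof.
apply/funext => u; apply/funext => x; rewrite /Defs.coef big_map big1 // => p _ /=.
rewrite (_ : cut _ _ = fun=> 0) ?alpha0 ?if_same //.
by apply/funext => y; rewrite /cut asboolF.
Qed.

(* Near x, two terms with the same germ at x can be moved modulo N onto a common
   lower bound u and merged; a term whose germ occurs once vanishes near x. *)
Lemma Psi0_local l x : valid l -> (forall t, Psi l t x = 0) ->
  exists W, W x /\ hcopen (fun W => inN (coef (restrict W l))) W.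
Proof.
have [n] := ubnP (size l); elim: n l => // n IH [|[s a] l] szl vl P0.
  have [W [cW Wx _]] := copen_basis lcX zX (@openT X) (I : setT x).
  exists W; split=> //; split=> // W' _ _.
  rewrite (_ : coef _ = fun _ _ => 0); first exact: inN0.
  by apply/funext => u; apply/funext => y; rewrite /Defs.coef big_nil.
have Da : inD s a by apply: (vl (s, a)); left.
have vl' : valid l by move=> p pl; apply: vl; right.
pose b := alpha (star s) a.
have [lb _ _] := (inDP _ _).1 (inD_alphaV Da).
(* A coefficient that is 0 at x is 0 on a neighbourhood, so a small W erases the head. *)
have [bx|bx] := eqVneq (b x) 0.
  have [|t|W1 [W1x [cW1 H1]]] := IH l _ vl'; first by [].
    by have := P0 t; rewrite /Psi big_cons /= -/b bx if_same add0r.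
  have [U [oU Ux Ub]] := lb x.
  have [W [cW Wx WU]] :=
    copen_basis lcX zX (openI cW1.1 oU) (conj W1x Ux).
  exists W; split=> //; split=> // W' cW' W'W.
  rewrite (_ : coef _ = coef (restrict W' l)).
    by apply: H1 => // y /W'W/WU[].
  apply/funext => u; apply/funext => y.
  rewrite /Defs.coef big_cons /= (_ : cut _ _ = fun=> 0) ?alpha0 ?if_same ?add0r //.
  apply/funext => z; rewrite /cut; case: asboolP => // /W'W/WU[_ Uz].
  by rewrite Ub.
have sx : Xs (star s) x by exact: (alpha_supp bx).
have [[[t c] [tl /= st]]|nst] :=
    pselect (exists p, List.In p l /\ germeq s x p.1 x); last first.
  have := P0 s; rewrite /Psi big_cons /= asboolT; last exact: germ_refl.
  rewrite (eq_big_In (G := fun=> 0)).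
    by rewrite big1_eq addr0 => bx0; rewrite /b bx0 eqxx in bx.
  by move=> p pl; rewrite asboolF // => sp; apply: nst; exists p.
have [l1 [l2 E]] := List.in_split (t, c) l tl; change (l = l1 ++ (t, c) :: l2) in E.
have Dc : inD t c by exact: (vl' (t, c)).
pose g := alpha (star t) c.
have [lg _ _] := (inDP _ _).1 (inD_alphaV Dc).
have [_ [u [us ut ux]]] := st.
have [W0 [cW0 W0x W0u]] := copen_basis lcX zX (Xs_open (star u)) ux.
(* Cutting by W0 keeps the sum inside X_{u*}, where [alpha u] can transport it, and changes nothing
   at x. *)
pose d := cut W0 (fun y => b y + g y).
have Dd : inD (star u) d by apply: inD_cut => //; exact: loc_const_op2.
have dK : alpha (star u) (alpha u d) = d.
  by apply: alphaK => y /cut_supp/W0u.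
have [| | |W1 [W1x [cW1 H1]]] := IH ((u, alpha u d) :: l1 ++ l2).
- by move: szl; rewrite E /= !size_cat /= !addnS.
- move=> p [<-|pl]; first exact: inD_alpha.
  apply: vl'; rewrite E; case: (List.in_app_or l1 l2 p pl) => pl'.
    by apply: List.in_or_app; left.
  by apply: List.in_or_app; right; right.
- move=> t'; rewrite -(P0 t') E /Psi !big_cons !big_cat !big_cons /=.
  rewrite dK; set s1 := \sum_(p <- l1) _; set s2 := \sum_(p <- l2) _.
  have -> : `[< germeq t' x u x >] = `[< germeq t' x s x >].
    have H := germ_le us ux.
    by apply/asbool_equiv_eq; split=> H'; apply: germ_trans H' _ => //; exact: germ_sym.
  have -> : `[< germeq t' x t x >] = `[< germeq t' x s x >].
    by apply/asbool_equiv_eq; split=> H'; apply: germ_trans H' _ => //; exact: germ_sym.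
  rewrite /d /cut (asboolT W0x) -/b -/g; case: ifP => _; last by rewrite !add0r.
  by move: (b x) (g x) s1 s2 => *; ring.
have [W [cW Wx WW]] :=
  copen_basis lcX zX (openI cW1.1 cW0.1) (conj W1x W0x).
exists W; split=> //; split=> // W' cW' W'W.
have W'u : W' `<=` Xs (star u) by move=> y /W'W/WW[_ /W0u].
have cu f : supp (cut W' f) `<=` Xs (star u) by move=> y /cut_supp/W'u.
pose A := alpha u (cut W' b); pose C := alpha u (cut W' g).
have DA : inD u A by apply/inD_alpha/inD_cut.
have DC : inD u C by apply/inD_alpha/inD_cut.
have H : inN (coef (restrict W' ((u, alpha u d) :: l1 ++ l2))).
  by apply: H1 => // y /W'W/WW[].
(* In H, the single coefficient A + C at u stands for both terms; the two generators move A back to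
   s and C back to t. *)
have := inN_add (inN_add H (inN_gen us DA)) (inN_gen ut DC).
congr inN; apply/funext => v; apply/funext => y.
rewrite /restrict /= dK (_ : alpha u (cut W' d) = fun z => A z + C z); last first.
  rewrite /A /C -alphaD; congr (alpha _ _); apply/funext => z.
  rewrite /d /cut; case: (asboolP (W' z)) => W'z; last by rewrite addr0.
  by rewrite asboolT //; have [_] := WW _ (W'W _ W'z).
rewrite -/b -(alpha_le us (cu b)) -/A E !map_cat /= -/g.
rewrite -(alpha_le ut (cu g)) -/C /Defs.coef !big_cons !big_cat !big_cons /=.
set s1 := \sum_(p <- map _ l1) _; set s2 := \sum_(p <- map _ l2) _.
case: (asboolP (s = v)) => _; case: (asboolP (t = v)) => _; case: (asboolP (u = v)) => _;
  by rewrite ?addr0 ?add0r ?subrr ?addr0; ring.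
Qed.

(** The pulled-back supports are compact, so [Psi0_local] glues to one compact open W containing
    them all; restricting l to W then leaves its coefficients unchanged. *)
Lemma Psi0_inN l : valid l -> (forall t x, Psi l t x = 0) -> inN (coef l).
Proof.
move=> vl P0; pose P W := inN (coef (restrict W l)).
have P_0 : P set0 by rewrite /P coef_restrict0; exact: inN0.
have PU W W' : copen W -> copen W' ->
    (forall x, W x -> ~ W' x) -> P W -> P W' -> P (W `|` W').
  by move=> _ _ WW' PW PW'; rewrite /P coef_restrictU //; exact: inN_add.
have loc x : exists W, W x /\ hcopen P W by exact: Psi0_local.
have gen l' : valid l' -> exists W,
    (forall p, List.In p l' -> supp (alpha (star p.1) p.2) `<=` W) /\ hcopen P W.
  elim: l' => [_|p l' IH vl'].
    by exists set0; split=> [? []|]; split; [exact: copen0|move=> W _; rewrite subset0 => ->].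
  have [q ql|W [WP hW]] := IH; first by apply: vl'; right.
  have [_ cK _] := (inDP _ _).1 (inD_alphaV (vl' p (or_introl erefl))).
  have [W2 [W2P hW2]] := hcopen_cover hX P_0 PU cK (fun x _ => loc x).
  exists (W `|` W2); split; last exact: hcopenU.
  by move=> q [<-|/WP qW] x; [move/W2P; right|move/qW; left].
have [W [WP [cW hW]]] := gen l vl.
have := hW W cW (@subset_refl _ W); congr inN.
apply/funext => u; apply/funext => x; rewrite /Defs.coef big_map.
apply: eq_big_In => p pl /=; case: asboolP => // _.
have [_ _ sp] := (inDP _ _).1 (vl _ pl).
rewrite -{2}(alphaVK sp); congr (alpha _ _ x); apply/funext => y.
rewrite /cut; case: asboolP => // nW; apply/esym/eqP; apply: contrapT => /negP.
by move/(WP _ pl).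
Qed.

Lemma Psi_eq_inN l l' : valid l -> valid l' -> (forall t x, Psi l t x = Psi l' t x) ->
  inN (cdiff (coef l) (coef l')).
Proof.
move=> vl vl' ll'; rewrite (_ : cdiff _ _ = coef (l ++ scaleL (-1) l')).
  apply: Psi0_inN; first by apply: valid_cat => //; exact: valid_scale.
  by move=> t x; rewrite Psi_cat Psi_scale mulN1r ll' subrr.
by apply/funext => u; apply/funext => x; rewrite coef_cat coef_scale mulN1r.
Qed.

(** * The image *)

Local Notation cob := (compact_open_bisection mul star Xs th).

Lemma is_germset_basic s W : is_germset mul star Xs (basic s W).
Proof.
split=> [t x [] //|t x t' y t'y tt' [tx Wx ts]].
have [E _] := tt'; rewrite -{}E in t'y tt' *; split=> //.
exact: germ_trans (germ_sym tt') ts.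
Qed.

Lemma gopen_basic s W : open W -> W `<=` Xs (star s) -> gopen mul star Xs (basic s W).
Proof.
move=> oW Ws; split; first exact: is_germset_basic.
by move=> t x tx; exists s, W; split.
Qed.

(** A basic set [t,U] inside B around [s,x] may use another index t, but s and t have the same germs
    throughout X_{u*} for a common lower bound u. *)
Lemma gopen_slice B s : gopen mul star Xs B -> open [set x | B s x].
Proof.
case=> [[_ gB] oB]; rewrite openE => x /= /oB[t [U [oU Ut [sx Ux st] UB]]].
have [_ [u [us ut ux]]] := st.
have oV : open (U `&` Xs (star u)) by apply: openI => //; exact: Xs_open.
apply: filterS (open_nbhs_nbhs (conj oV (conj Ux ux))) => y [Uy uy] /=.
have su := germ_sym (germ_le us uy).
by apply: UB; split=> //; [exact: germ_dom su|exact: germ_trans su (germ_le ut uy)].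
Qed.

(** The section sending y to [s,y] pulls an open cover of the slice back to one of W, by
    [gopen_slice]; injectivity of the range comes from that of θ_s. *)
Lemma cob_basic s W : copen W -> W `<=` Xs (star s) -> cob (basic s W).
Proof.
move=> [oW cW] Ws; split; first exact: gopen_basic.
  move=> I V oV cV.
  have [|x Wx|l lP] := @compact_seq_cover _ W I (fun i => [set x | V i s x]) cW.
  - by move=> i; exact: gopen_slice.
  - by apply: cV; split=> //; [exact: Ws|apply/germ_refl/Ws].
  exists l => t x [tx Wx ts]; have [i [il Vi]] := lP x Wx.
  by exists i; split=> //; case: (oV i) => [[_ gV] _]; apply: gV Vi => //; exact: germ_sym.
move=> t x t' y [tx Wx ts] [t'y Wy t's]; split.
  by move=> E; rewrite -E in t's *; exact: germ_trans ts (germ_sym t's).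
rewrite (germ_th ts) (germ_th t's) => /(th_inj (Ws _ Wx) (Ws _ Wy)) E.
by rewrite -E in t's *; exact: germ_trans ts (germ_sym t's).
Qed.

Lemma steinberg0 : steinberg (fun _ _ => 0).
Proof. by exists [::]; split=> [? []|s x]; rewrite big_nil if_same. Qed.

Lemma steinberg_add f g : steinberg f -> steinberg g ->
  steinberg (fun s x => f s x + g s x).
Proof.
case=> l [lP fE] [l' [lP' gE]]; exists (l ++ l'); split.
  by move=> p pl; case: (List.in_app_or l l' p pl) => [/lP|/lP'].
by move=> s x; rewrite fE gE big_cat; case: asboolP; rewrite ?addr0.
Qed.

Lemma steinberg_basic r s W : copen W -> W `<=` Xs (star s) ->
  steinberg (fun t x => if `[< germeq t x s x /\ W x >] then r else 0).
Proof.
move=> cW Ws; exists [:: (r, basic s W)]; split.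
  by move=> _ [<-|[]] /=; exact: cob_basic.
move=> t x; rewrite big_seq1 /=; case: (asboolP (Xs (star t) x)) => tx.
  congr (if _ then _ else _); apply/asbool_equiv_eq.
  by split=> [[]|[]].
by rewrite asboolF // => -[/germ_dom].
Qed.

(** Where the coefficient is constant this is a multiple of the indicator of a slice; disjoint
    gluing covers the compact support. *)
Lemma steinberg_delta s a : inD s a ->
  steinberg (fun t x => if `[< germeq t x s x >] then alpha (star s) a x else 0).
Proof.
move=> Da; have [lb cb sb] := (inDP _ _).1 (inD_alphaV Da).
set b := alpha (star s) a in lb cb sb *.
pose P W := steinberg (fun t x => if `[< germeq t x s x >] then cut W b x else 0).
have P0 : P set0.
  rewrite /P (_ : (fun t x => _) = fun _ _ => 0); first exact: steinberg0.
  by apply/funext => t; apply/funext => x; rewrite /cut (asboolF (P := set0 x)) ?if_same.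
have PU W W' : copen W -> copen W' ->
    (forall x, W x -> ~ W' x) -> P W -> P W' -> P (W `|` W').
  move=> _ _ WW' PW PW'; have := steinberg_add PW PW'; congr steinberg.
  apply/funext => t; apply/funext => x; case: asboolP => _; last by rewrite addr0.
  rewrite /cut; case: (asboolP (W x)) => Wx.
    by rewrite asboolF ?asboolT ?addr0 //; [left|exact: WW'].
  rewrite add0r; case: (asboolP (W' x)) => W'x; first by rewrite asboolT //; right.
  by rewrite asboolF // => -[].
have [x bx|W [bW [cW hW]]] := hcopen_cover hX P0 PU cb.
  have [U [oU Ux Ub]] := lb x.
  have [W [cW Wx WU]] :=
    copen_basis lcX zX (openI oU (Xs_open (star s))) (conj Ux (sb _ bx)).
  exists W; split=> //; split=> // W' cW' W'W.
  have W's : W' `<=` Xs (star s) by move=> y /W'W/WU[].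
  have := steinberg_basic (b x) cW' W's; congr steinberg.
  apply/funext => t; apply/funext => y; rewrite /cut.
  case: (asboolP (W' y)) => W'y; last by rewrite if_same asboolF // => -[].
  rewrite Ub; last by have [] := WU _ (W'W _ W'y).
  by congr (if _ then _ else _); apply/asbool_equiv_eq; split=> [[]|].
have := hW W cW (@subset_refl _ W); congr steinberg.
apply/funext => t; apply/funext => x; case: asboolP => // _.
rewrite /cut; case: asboolP => // nW; apply/esym/eqP; apply: contrapT => /negP.
by move/bW.
Qed.

Lemma steinberg_Psi l : valid l -> steinberg (Psi l).
Proof.
elim: l => [_|p l IH vl].
  rewrite (_ : Psi [::] = fun _ _ => 0); first exact: steinberg0.
  by apply/funext => t; apply/funext => x; rewrite /Psi big_nil.
have vp : inD p.1 p.2 by apply: vl; left.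
have vl' : valid l by move=> q ql; apply: vl; right.
have := steinberg_add (steinberg_delta vp) (IH vl'); congr steinberg.
by apply/funext => t; apply/funext => x; rewrite /Psi big_cons.
Qed.

(** Finitely many slices cover B but may overlap. Since a bisection has at most one germ over each
    source point, making their bases disjoint in X suffices. *)
Lemma Psi_cob r B : cob B ->
  exists l, valid l /\ forall t x, Psi l t x = if `[< B t x >] then r else 0.
Proof.
case=> [[[Bd Bg] oB] cB bB].
pose P W := exists l, valid l /\
  forall t x, Psi l t x = if `[< B t x /\ W x >] then r else 0.
have P0 : P set0.
  exists [::]; split; first by move=> ? [].
  by move=> t x; rewrite /Psi big_nil asboolF // => -[].
have PU W W' : copen W -> copen W' ->
    (forall x, W x -> ~ W' x) -> P W -> P W' -> P (W `|` W').
  move=> _ _ WW' [l [vl lE]] [l' [vl' lE']]; exists (l ++ l'); split.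
    exact: valid_cat.
  move=> t x; rewrite Psi_cat lE lE'.
  case: (asboolP (B t x /\ W x)) => [[Bx Wx]|nW].
    rewrite asboolF; last by case=> _; exact: WW'.
    by rewrite addr0 asboolT //; split=> //; left.
  rewrite add0r; congr (if _ then _ else _); apply/asbool_equiv_eq.
  split=> [[Bx W'x]|[Bx [Wx|W'x]]] //; first by split=> //; right.
  by case: nW.
pose I := {p : S * set X | [/\ copen p.2, p.2 `<=` Xs (star p.1) &
                           forall t x, basic p.1 p.2 t x -> B t x]}.
have [||l lP] := cB I (fun i => basic (sval i).1 (sval i).2).
- by move=> [p [[oW cW] Ws pB]] /=; exact: gopen_basic.
- move=> s x /oB[t [U [oU Ut [sx Ux st] UB]]].
  have [W [cW Wx WU]] := copen_basis lcX zX oU Ux.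
  have p1 : W `<=` Xs (star t) by move=> y /WU/Ut.
  have p2 : forall s x, basic t W s x -> B s x.
    by move=> s' y [s'y Wy s't]; apply: UB; split=> //; exact: WU.
  by exists (exist _ (t, W) (And3 cW p1 p2)); split.
have [cW hW] : hcopen P [set x | exists i, List.In i l /\ (sval i).2 x].
  apply: hcopen_seq => // -[[s W] /= [cW Ws WB]] _; split=> // W' cW' W'W.
  have W's : W' `<=` Xs (star s) by move=> y /W'W/Ws.
  have Dr : inD (star s) (cut W' (fun=> r)).
    by apply: inD_cut => //; exact: loc_const_cst.
  exists [:: (s, alpha s (cut W' (fun=> r)))]; split.
    by move=> _ [<-|[]] /=; exact: inD_alpha.
  move=> t x; rewrite /Psi big_seq1 /= alphaK; last by case: Dr.
  rewrite /cut; case: (asboolP (W' x)) => W'x; last first.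
    by rewrite if_same asboolF // => -[].
  have Bsx : B s x.
    by apply: WB; split; [exact: W's|exact: W'W|apply/germ_refl/W's].
  congr (if _ then _ else _); apply/asbool_equiv_eq; split.
    by move=> ts; split=> //; apply: WB; split=> //; [exact: germ_dom ts|exact: W'W].
  (* Both [t,x] and [s,x] lie in B over the same source, so they are equal. *)
  by case=> Bt _; have [+ _] := bB _ _ _ _ Bt Bsx; exact.
have [l' [vl' lE']] := hW _ cW (@subset_refl _ _); exists l'; split=> // t x.
rewrite lE'; congr (if _ then _ else _); apply/asbool_equiv_eq; split=> [[]//|Bt].
by split=> //; have [i [il [_ ix _]]] := lP _ _ Bt; exists i.
Qed.

Lemma steinbergP f : steinberg f <-> exists l, valid l /\ Psi l = f.
Proof.
split; last by case=> l [vl <-]; exact: steinberg_Psi.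
case=> L [LP fE].
have [l [vl lE]] : exists l, valid l /\
    forall t x, Psi l t x = \sum_(p <- L) (if `[< p.2 t x >] then p.1 else 0).
  elim: L LP {fE} => [_|p L IH LP].
    by exists [::]; split=> [? []|t x]; rewrite /Psi !big_nil.
  have [q ql|l [vl lE]] := IH; first by apply: LP; right.
  have [l' [vl' lE']] := Psi_cob p.1 (LP p (or_introl erefl)).
  exists (l' ++ l); split; first exact: valid_cat.
  by move=> t x; rewrite Psi_cat big_cons lE lE'.
exists l; split=> //; apply/funext => t; apply/funext => x.
rewrite fE -lE; case: asboolP => // ntx; rewrite /Psi big1 // => p _.
by rewrite asboolF // => /germ_dom.
Qed.

(** * Convolution *)

Section Representatives.
Variables (T : Type) (E : T -> T -> Prop).
Hypotheses (Esym : forall p q, E p q -> E q p).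
Hypothesis (Etrans : forall q p r, E p q -> E q r -> E p r).

Let irr l := pairwise (fun p q => `[< ~ E p q >]) l.

Lemma all_In (P : T -> bool) l : all P l <-> forall p, List.In p l -> P p.
Proof.
elim: l => [|p l IH] /=; first by split.
split=> [/andP[Pp /IH H] q [<-//|/H//]|H]; apply/andP; split; first by apply: H; left.
by apply/IH => q ql; apply: H; right.
Qed.

(** Supplies the repetition-free lists demanded by [conv]. Reflexivity is asked only on D because
    germ equality is reflexive only on domains. *)
Lemma representatives (D : T -> Prop) (L : seq T) : (forall p, D p -> E p p) ->
  exists l, [/\ forall p, List.In p l -> D p, irr l &
    forall p, List.In p L -> D p -> exists q, List.In q l /\ E p q].
Proof.
move=> Er; elim: L => [|p L [l [lD il lE]]]; first by exists [::]; split=> // ? [].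
have [npq|npq] := pselect (D p -> exists q, List.In q l /\ E p q).
  by exists l; split=> // q [<-|] //; exact: lE.
have Dp : D p by apply: contrapT => nDp; apply: npq => /nDp.
exists (p :: l); split.
- by move=> q [<-|/lD].
- rewrite /irr /= -/(irr l) il andbT; apply/all_In => q ql.
  by apply/asboolP => pq; apply: npq => _; exists q.
- move=> q [<- _|qL Dq]; first by exists p; split; [left|exact: Er].
  by have [r [rl qr]] := lE q qL Dq; exists r; split=> //; right.
Qed.

Lemma sum_representative l p q (c : R) : irr l -> List.In q l -> E p q ->
  \sum_(r <- l) (if `[< E p r >] then c else 0) = c.
Proof.
move=> + + pq; elim: l => //= h l IH /andP[/all_In hl il] ql; rewrite big_cons.
have [ph|nph] := pselect (E p h).
  rewrite (asboolT ph) (eq_big_In (G := fun=> 0)) ?big1_eq ?addr0 // => r rl.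
  rewrite asboolF // => pr; have /asboolP := hl _ rl; apply.
  by apply: Etrans pr; exact: Esym.
rewrite (asboolF nph) add0r; apply: IH => //.
by case: ql => // hq; case: nph; rewrite hq.
Qed.

(** Both sums equal the double sum of F over equivalent pairs from the two lists, since each nonzero
    entry has exactly one partner. Hence a convolution value is independent of the enumeration. *)
Lemma sum_representatives l l' (F : T -> R) : irr l -> irr l' ->
  (forall p q, E p q -> F p = F q) ->
  (forall p, List.In p l -> F p != 0 -> exists q, List.In q l' /\ E p q) ->
  (forall p, List.In p l' -> F p != 0 -> exists q, List.In q l /\ E p q) ->
  \sum_(p <- l) F p = \sum_(p <- l') F p.
Proof.
move=> il il' FE ll' l'l.
have half k k' : irr k' ->
    (forall p, List.In p k -> F p != 0 -> exists q, List.In q k' /\ E p q) ->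
    \sum_(p <- k) F p = \sum_(p <- k) \sum_(q <- k') (if `[< E p q >] then F p else 0).
  move=> ik' kk'; apply: eq_big_In => p pk; have [->|Fp] := eqVneq (F p) 0.
    by rewrite big1 // => q _; rewrite if_same.
  by have [q [qk' pq]] := kk' p pk Fp; rewrite (sum_representative _ ik' qk' pq).
rewrite (half l l') // (half l' l) // exchange_big; apply: eq_bigr => q _.
apply: eq_bigr => p _; case: asboolP => [pq|npq].
  by rewrite (asboolT (Esym pq)); exact: FE.
by rewrite asboolF // => qp; apply: npq; exact: Esym.
Qed.

End Representatives.

Local Notation same_pair := (Defs.same_pair mul star Xs th).

Lemma same_pair_sym x p q : same_pair x p q -> same_pair x q p.
Proof. by case=> ? ?; split; exact: germ_sym. Qed.

Lemma same_pair_trans x q p r : same_pair x p q -> same_pair x q r -> same_pair x p r.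
Proof. by move=> [pq2 pq1] [qr2 qr1]; split; [exact: germ_trans qr2|exact: germ_trans qr1]. Qed.

Definition factors (u : S) (x : X) (p : S * S) : Prop :=
  [/\ Xs (star p.2) x, Xs (star p.1) (th p.2 x) & germeq (mul p.1 p.2) x u x].

Lemma factors_same u x p q : same_pair x p q -> factors u x q -> factors u x p.
Proof.
move=> [H2 H1] [q2 q1 qu]; split; [exact: germ_dom H2|exact: germ_dom H1|].
exact: germ_trans (germ_mul H2 H1) qu.
Qed.

Lemma In_pairs (l1 l2 : formal) p q : List.In p l1 -> List.In q l2 ->
  List.In (p.1, q.1) [seq (p.1, q.1) | p <- l1, q <- l2].
Proof.
move=> + ql; elim: l1 => //= h k IH [->|pk]; apply: List.in_or_app; last by right; exact: IH.
by left; elim: l2 ql {IH} => //= h' k' IH' [->|qk']; [left|right; exact: IH'].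
Qed.

Lemma conv_Psi l1 l2 : valid l1 -> valid l2 ->
  conv (Psi l1) (Psi l2) (Psi (mulL l1 l2)).
Proof.
move=> v1 v2; split=> [u x nux|u x ux].
  by rewrite /Psi big1 // => p _; rewrite asboolF // => /germ_dom.
pose L : seq (S * S) := [seq (p.1, q.1) | p <- l1, q <- l2].
have refl p : factors u x p -> same_pair x p p.
  by case=> p2 p1 _; split; exact: germ_refl.
have [l [lD il lE]] := representatives L refl.
exists l; split=> //.
  move=> s t tx sx stu fg.
  have fst : factors u x (s, t) by split.
  have [f0 g0] : Psi l1 s (th t x) != 0 /\ Psi l2 t x != 0.
    by split; apply: contra_neq fg => ->; rewrite ?mulr0 ?mul0r.
  have ex k r y : Psi k r y != 0 -> exists p, List.In p k /\ germeq r y p.1 y.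
    move=> k0; apply: contrapT => nk; move/eqP: k0; apply.
    rewrite /Psi (eq_big_In (G := fun=> 0)) ?big1_eq // => p pk.
    by rewrite asboolF // => rp; apply: nk; exists p.
  have [p [pl sp]] := ex _ _ _ f0; have [q [ql tq]] := ex _ _ _ g0.
  have spq : same_pair x (s, t) (p.1, q.1).
    by split=> //=; rewrite -(germ_th tq).
  have [|r [rl pqr]] := lE (p.1, q.1) _ (factors_same (same_pair_sym spq) fst).
    exact: In_pairs.
  by exists r; split=> //; exact: same_pair_trans spq pqr.
pose beta (p : S * (X -> R)) := alpha (star p.1) p.2.
(* By [alphaM] each term becomes a product of values; if its indices are not composable at x, that
   product is 0. *)
transitivity (\sum_(p <- l1) \sum_(q <- l2)
    (if `[< factors u x (p.1, q.1) >] then beta p (th q.1 x) * beta q x else 0)).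
  rewrite /Psi /Defs.mulL big_allpairs_dep; apply: eq_big_In => p pl.
  apply: eq_big_In => q ql /=.
  have [_ _ sq] := (inDP _ _).1 (v2 q ql).
  case: asboolP => [upq|nupq]; last first.
    by rewrite asboolF // => -[_ _ /germ_sym].
  rewrite alphaM //; last exact: germ_domr upq.
  case: asboolP => // nf; apply/eqP; apply: contrapT => /negP pq0; apply: nf.
  have [bp bq] : beta p (th q.1 x) != 0 /\ beta q x != 0.
    by split; apply: contra_neq pq0; rewrite /beta => ->; rewrite ?mulr0 ?mul0r.
  by split; [exact: alpha_supp bq|exact: alpha_supp bp|exact: germ_sym].
(* A factoring pair matches exactly one r, so a sum over l can be inserted; after exchanging sums,
   each r collects a product of two values of [Psi]. *)
transitivity (\sum_(p <- l1) \sum_(q <- l2) \sum_(r <- l)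
    (if `[< same_pair x (p.1, q.1) r >] then beta p (th q.1 x) * beta q x else 0)).
  apply: eq_big_In => p pl; apply: eq_big_In => q ql.
  case: asboolP => [fpq|nfpq].
    have [|r [rl pqr]] := lE (p.1, q.1) _ fpq.
      exact: In_pairs.
    by rewrite (sum_representative (@same_pair_sym x) (@same_pair_trans x) _ il rl pqr).
  rewrite (eq_big_In (G := fun=> 0)) ?big1_eq // => r rl.
  by rewrite asboolF // => pqr; apply: nfpq; exact: factors_same pqr (lD _ rl).
under eq_bigr do rewrite exchange_big.
rewrite exchange_big; apply: eq_bigr => r _.
rewrite /Psi mulr_suml; apply: eq_bigr => p _; rewrite mulr_sumr; apply: eq_bigr => q _.
rewrite -/(beta p) -/(beta q).
case: (asboolP (germeq r.2 x q.1 x)) => [rq|nrq]; last first.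
  by rewrite mulr0 asboolF // => -[/= /germ_sym].
rewrite (germ_th rq); case: (asboolP (germeq r.1 _ p.1 _)) => [rp|nrp].
  rewrite asboolT //; split; first exact: germ_sym.
  by rewrite /= (germ_th rq); exact: germ_sym.
by rewrite mul0r asboolF // => -[/= _ /germ_sym]; rewrite (germ_th rq).
Qed.

(** As [conv] is a relation, this is what identifies a given product h with [Psi] of [mulL]. *)
Lemma conv_uniq l1 l2 h h' : conv (Psi l1) (Psi l2) h -> conv (Psi l1) (Psi l2) h' -> h = h'.
Proof.
move=> [h0 hP] [h'0 h'P]; apply/funext => u; apply/funext => x.
have [ux|nux] := pselect (Xs (star u) x); last by rewrite h0 ?h'0.
have [l [lD il lE ->]] := hP u x ux; have [l' [lD' il' lE' ->]] := h'P u x ux.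
apply: (sum_representatives (@same_pair_sym x) (@same_pair_trans x) il il').
- move=> p q [H2 H1]; rewrite (Psi_germ l2 H2) (Psi_germ l1 H1) //.
- by move=> [s t] /lD[/= tx sx stu]; exact: lE'.
- by move=> [s t] /lD'[/= tx sx stu]; exact: lE.
Qed.

Lemma steinberg_crossed_iso_holds : steinberg_crossed_iso mul star Xs th R.
Proof.
have [|Phi PhiP] := @choice _ _ (fun f l => steinberg f -> valid l /\ Psi l = f).
  move=> f; have [/steinbergP[l lP]|nf] := pselect (steinberg f).
    by exists l.
  by exists [::].
have vPhi f : steinberg f -> valid (Phi f) by case/PhiP.
have PhiK f : steinberg f -> Psi (Phi f) = f by case/PhiP.
have PsiP l f : valid l -> Psi l = f -> steinberg f by move=> vl <-; exact: steinberg_Psi.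
split.
  move=> f g Sf Sg; exists (Psi (mulL (Phi f) (Phi g))); split.
    by apply/steinberg_Psi/valid_mulL; exact: vPhi.
  by rewrite -{1}(PhiK f Sf) -{1}(PhiK g Sg); apply: conv_Psi; exact: vPhi.
exists Phi; split; first exact: vPhi.
split=> [f g Sf Sg|].
  have vfg := valid_cat (vPhi f Sf) (vPhi g Sg).
  have E : Psi (Phi f ++ Phi g) = gadd f g.
    by apply/funext => t; apply/funext => x; rewrite Psi_cat !PhiK.
  have Sfg := PsiP _ _ vfg E.
  rewrite (_ : (fun u x => _) = coef (Phi f ++ Phi g)).
    by apply: Psi_eq_inN => //; [exact: vPhi|rewrite PhiK // E].
  by apply/funext => u; apply/funext => x; rewrite coef_cat.
split=> [r f Sf|].
  have vrf := @valid_scale r _ (vPhi f Sf).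
  have E : Psi (scaleL r (Phi f)) = gscale r f.
    by apply/funext => t; apply/funext => x; rewrite Psi_scale PhiK.
  have Srf := PsiP _ _ vrf E.
  rewrite (_ : (fun u x => _) = coef (scaleL r (Phi f))).
    by apply: Psi_eq_inN => //; [exact: vPhi|rewrite PhiK // E].
  by apply/funext => u; apply/funext => x; rewrite coef_scale.
split=> [f g h Sf Sg Sh fgh|].
  apply: Psi_eq_inN; [exact: vPhi|by apply: valid_mulL; exact: vPhi|].
  rewrite PhiK // -(PhiK f Sf) -(PhiK g Sg) in fgh *.
  by rewrite (conv_uniq fgh (conv_Psi (vPhi _ Sf) (vPhi _ Sg))) !PhiK.
(* Injectivity uses the other inclusion, that [Psi] kills N, applied to the first list followed by
   the negated second. *)
split=> [f g Sf Sg N|l vl].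
  apply/funext => t; apply/funext => x; apply/eqP; rewrite -subr_eq0; apply/eqP.
  have := @Psi_inN (Phi f ++ scaleL (-1) (Phi g)) t x.
  rewrite Psi_cat Psi_scale mulN1r !PhiK //; apply.
  move: N; congr inN; apply/funext => u; apply/funext => y.
  by rewrite coef_cat coef_scale mulN1r.
exists (Psi l); have SP := steinberg_Psi vl; split=> //.
by apply: Psi_eq_inN => //; [exact: vPhi|rewrite PhiK].
Qed.

End PartialActionTheory.

Theorem theorem5p10 (R : comPzRingType) (S : Type) (mul : S -> S -> S) (star : S -> S)
  (X : topologicalType) (Xs : S -> set X) (th : S -> X -> X) :
  inverse_semigroup mul star ->
  hausdorff_space X -> locally_compact [set: X] -> zero_dimensional X ->
  top_partial_action mul star Xs th ->
  steinberg_crossed_iso mul star Xs th R.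
Proof. exact: steinberg_crossed_iso_holds. Qed.
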